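(* Let $\mathbb{F}=\mathbb{R}$ or $\mathbb{C}$ and let $T\in\mathcal{A}_{\infty\to1}^{(2)}(\mathbb{F})$ be non-zero. Write $T=\begin{bmatrix}a&re^{i\theta}\\ re^{-i\theta}&b\end{bmatrix}$ with $a,b,r\ge0$, and $0\le\theta<2\pi$ if $\mathbb{F}=\mathbb{C}$, $\theta\in\{0,\pi\}$ if $\mathbb{F}=\mathbb{R}$. Then the following are equivalent. (i) $T$ is an extreme contraction, i.e. an extreme point of $\mathcal{A}_{\infty\to1}^{(2)}(\mathbb{F})$. (ii) $\operatorname{rank}(T)=1$ and $a+b+2r=1$.
   Context: $\mathcal{A}_{\infty\to1}^{(n)}(\mathbb{F})=\{T\in M_n(\mathbb{F}):T\ge0,\ \|T\|_{\infty\to1}\le1\}$, where $T\ge0$ means self-adjoint non-negative definite and $\|T\|_{\infty\to1}$ is the operator norm of $T:\ell_\infty^n(\mathbb{F})\to\ell_1^n(\mathbb{F})$ with respect to the canonical basis. *)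

(* Defs.v *)
From mathcomp Require Import all_boot all_order all_algebra.
From mathcomp Require Import complex.
From mathcomp Require Import all_classical all_reals all_analysis.

Set Implicit Arguments.
Unset Strict Implicit.
Unset Printing Implicit Defensive.

Import Order.TTheory GRing.Theory Num.Theory.

Local Open Scope classical_set_scope.
Local Open Scope ring_scope.
Local Open Scope complex_scope.

Variant scalar_kind := RealScalars | ComplexScalars.

Section Scalars.
Context (R : realType).

Definition scalar_field (k : scalar_kind) : numFieldType :=
  match k with
  | RealScalars => R
  | ComplexScalars => R[i]
  end.

Definition scalar_conj (k : scalar_kind) :
    {rmorphism scalar_field k -> scalar_field k} :=
  match k with
  | RealScalars => idfun : {rmorphism R -> R}
  | ComplexScalars => Num.conj : {rmorphism R[i] -> R[i]}
  end.

(* The modulus, with values in R (the library norm of R[i] is valued in R[i]). *)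
Definition scalar_abs (k : scalar_kind) : scalar_field k -> R :=
  match k with
  | RealScalars => fun x => `|x|
  | ComplexScalars => fun z => complex.Re `|z|
  end.

Definition scalar_of_real (k : scalar_kind) : R -> scalar_field k :=
  match k with
  | RealScalars => fun x => x
  | ComplexScalars => fun x => x%:C
  end.

(* e^(i theta); over the reals it is used only for theta = 0 or pi, where
   sin theta = 0. *)
Definition scalar_expi (k : scalar_kind) : R -> scalar_field k :=
  match k with
  | RealScalars => fun theta => cos theta
  | ComplexScalars => fun theta => cos theta +i* sin theta
  end.

Definition angle_range (k : scalar_kind) (theta : R) : Prop :=
  match k with
  | RealScalars => theta = 0 \/ theta = pi
  | ComplexScalars => 0 <= theta < 2 * pi
  end.

End Scalars.

(* For F = R[i] the order is the partial order of the library, in which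
   0 < t < 1 forces t to be real. *)
Definition extreme_point (F : numDomainType) (V : lmodType F) (A : set V)
    (x : V) : Prop :=
  A x /\
  forall (y z : V) (t : F), A y -> A z -> 0 < t < 1 ->
    x = t *: y + (1 - t) *: z -> y = x /\ z = x.

Section MatrixBall.
Context (R : realType) (k : scalar_kind) (n : nat).
Local Notation F := (scalar_field R k).

Definition linfty_norm (x : 'cV[F]_n) : R :=
  \big[Num.max/0]_(i < n) scalar_abs (x i 0).

Definition l1_norm (x : 'cV[F]_n) : R := \sum_(i < n) scalar_abs (x i 0).

Definition infty_one_norm (T : 'M[F]_n) : R :=
  sup [set l1_norm (T *m x) | x in [set x : 'cV[F]_n | linfty_norm x <= 1]].

(* For F = R[i], 0 <= z also says that z is real. *)
Definition nonneg_definite (T : 'M[F]_n) : Prop :=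
  T \is hermitianmx n false (scalar_conj R k) /\
  forall x : 'cV[F]_n, 0 <= (map_mx (scalar_conj R k) x^T *m T *m x) 0 0.

Definition A_infty_one : set 'M[F]_n :=
  [set T | nonneg_definite T /\ infty_one_norm T <= 1].

End MatrixBall.

Definition mx22 (F : nmodType) (a b c d : F) : 'M[F]_2 :=
  \matrix_(i < 2, j < 2) nth 0 (nth [::] [:: [:: a; b]; [:: c; d]] i) j.

Definition polar_mx (R : realType) (k : scalar_kind) (a b r theta : R) :
    'M[scalar_field R k]_2 :=
  mx22 (scalar_of_real k a)
       (scalar_of_real k r * scalar_expi k theta)
       (scalar_of_real k r * scalar_expi k (- theta))
       (scalar_of_real k b).

(* Main.v *)
Require Import Defs.
From HB Require Import structures.
From mathcomp Require Import all_boot all_order all_algebra.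
From mathcomp Require Import complex ring lra.
From mathcomp Require Import all_classical all_reals all_analysis.

Import Order.TTheory GRing.Theory Num.Theory.
Local Open Scope ring_scope.

(* For a Hermitian nonnegative M with diagonal (p, q) and corner c, the norm of
   M is p + q + 2|c|, so the ball is the set |c|^2 <= pq, p + q + 2|c| <= 1 of
   triples (p, q, c). An extreme nonzero M has norm 1, being otherwise inside
   the segment from 0 to M / ||M||, and satisfies pq = |c|^2, since otherwise
   (p + e, q - e, c) and (p - e, q + e, c) lie in the ball for small e > 0.
   Conversely, if pq = |c|^2 and the norm is 1, any decomposition
   M = t M1 + (1 - t) M2 in the ball forces M1 and M2 to have norm 1, rank one
   and equal diagonals; then |c1| = |c2| = |c| and c1 = c2 by strict convexity
   of the modulus. *)

(** * Real and complex scalars handled uniformly through a real-valued modulus *)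

Section ScalarTheory.
Context {R : realType} {k : scalar_kind}.
Local Notation F := (scalar_field R k).
Local Notation conj := (scalar_conj R k).
Local Notation toF := (@scalar_of_real R k).
Local Notation abs := (@scalar_abs R k).

Lemma scalar_of_real_is_zmod_morphism : zmod_morphism toF.
Proof. by case: k => x y //=; rewrite rmorphB. Qed.

Lemma scalar_of_real_is_monoid_morphism : monoid_morphism toF.
Proof. by case: k; split=> //= x y; rewrite rmorphM. Qed.

HB.instance Definition _ := GRing.isZmodMorphism.Build R F toF
  scalar_of_real_is_zmod_morphism.
HB.instance Definition _ := GRing.isMonoidMorphism.Build R F toF
  scalar_of_real_is_monoid_morphism.

Lemma scalar_of_real_le : {mono toF : x y / x <= y}.
Proof. by case: k => x y //=; rewrite lecR. Qed.

Lemma scalar_of_real_lt : {mono toF : x y / x < y}.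
Proof. by case: k => x y //=; rewrite ltcR. Qed.

Lemma scalar_of_real_ge0 x : (0 <= toF x) = (0 <= x).
Proof. by rewrite -(rmorph0 toF) scalar_of_real_le. Qed.

Lemma scalar_realP (x : F) : x \is Num.real -> exists y, x = toF y.
Proof.
case: k x => [x _|[u v]] /=; first by exists x.
by rewrite complex_real => /eqP /= ->; exists u.
Qed.

Lemma scalar_ge0P (x : F) : 0 <= x -> exists2 y, 0 <= y & x = toF y.
Proof.
move=> x0; have [y yE] := scalar_realP _ (ger0_real x0).
by exists y; rewrite -1?scalar_of_real_ge0 -?yE.
Qed.

Lemma scalar_conj_of_real x : conj (toF x) = toF x.
Proof. by case: k => //=; exact: conjc_real. Qed.

Lemma scalar_conjK : involutive conj.
Proof. by case: k => x //=; rewrite conjCK. Qed.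

(** This is the bridge to the library norm: facts about [abs] are pulled back from it along the
    injective, order-preserving embedding [toF]. *)
Lemma scalar_normE (x : F) : `|x| = toF (abs x).
Proof. by case: k x => //= x; rewrite -[LHS]/(_%:C)%C. Qed.

Lemma scalar_mul_conj (x : F) : x * conj x = toF (abs x ^+ 2).
Proof.
rewrite rmorphXn /= -scalar_normE.
by case: k x => x /=; rewrite -?normCK // real_normK ?num_real.
Qed.

Lemma scalar_abs_of_real x : 0 <= x -> abs (toF x) = x.
Proof.
move=> x0; apply: (fmorph_inj toF) => /=; rewrite -scalar_normE.
by rewrite ger0_norm // scalar_of_real_ge0.
Qed.

Lemma scalar_abs_ge0 (x : F) : 0 <= abs x.
Proof. by rewrite -scalar_of_real_ge0 -scalar_normE. Qed.

Lemma scalar_abs0_eq0 (x : F) : abs x = 0 -> x = 0.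
Proof. by move=> x0; apply/eqP; rewrite -normr_eq0 scalar_normE x0 rmorph0. Qed.

Lemma scalar_absD (x y : F) : abs (x + y) <= abs x + abs y.
Proof.
by rewrite -scalar_of_real_le rmorphD /= -!scalar_normE ler_normD.
Qed.

Lemma scalar_absM (x y : F) : abs (x * y) = abs x * abs y.
Proof.
by apply: (fmorph_inj toF); rewrite rmorphM /= -!scalar_normE normrM.
Qed.

Lemma scalar_abs_conj (x : F) : abs (conj x) = abs x.
Proof.
apply/eqP; rewrite -(eqrXn2 (n := 2)) ?scalar_abs_ge0 //; apply/eqP.
apply: (fmorph_inj toF) => /=; rewrite -!scalar_mul_conj scalar_conjK.
exact: mulrC.
Qed.

(** The witness is [conj c / |c|], or 1 when [c = 0]. It serves to build the vector at which the
    operator norm is attained. *)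
Lemma scalar_phase (c : F) : exists u : F,
  [/\ abs u = 1, c * u = toF (abs c) & conj c = toF (abs c) * u].
Proof.
have [c0|c0] := eqVneq (abs c) 0.
  exists 1; rewrite c0 (scalar_abs0_eq0 _ c0) !rmorph0 !mul0r; split=> //.
  by rewrite -(rmorph1 toF) scalar_abs_of_real.
have tc0 : toF (abs c) != 0 by rewrite fmorph_eq0.
exists (conj c / toF (abs c)); split.
- rewrite -fmorphV /= scalar_absM scalar_abs_conj scalar_abs_of_real ?divff //.
  by rewrite invr_ge0 scalar_abs_ge0.
- by rewrite mulrA scalar_mul_conj rmorphXn /= expr2 mulfK.
- by rewrite mulrCA divff // mulr1.
Qed.

(** With [c] the combination, t(1-t)|c1-c2|^2 = t|c1|^2 + (1-t)|c2|^2 - |c|^2, and the right side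
    vanishes when the three moduli agree. *)
Lemma scalar_abs_strictly_convex (t : R) (c1 c2 : F) :
  0 < t < 1 -> abs c1 = abs c2 ->
  abs (toF t * c1 + (1 - toF t) * c2) = abs c1 -> c1 = c2.
Proof.
move=> /andP[t0 t1] e12 e.
set c := _ + _ in e.
have E : toF t * (1 - toF t) * ((c1 - c2) * conj (c1 - c2)) =
    toF t * (c1 * conj c1) + (1 - toF t) * (c2 * conj c2) - c * conj c.
  rewrite /c !(rmorphB, rmorphD, rmorphM, rmorph1) /= !scalar_conj_of_real.
  by ring.
have : toF t * (1 - toF t) * ((c1 - c2) * conj (c1 - c2)) = 0.
  by rewrite E !scalar_mul_conj e e12; ring.
rewrite scalar_mul_conj -(rmorph1 toF) -rmorphB -!rmorphM /= => /eqP.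
rewrite fmorph_eq0 !mulf_eq0 (gt_eqF t0) subr_eq0 (gt_eqF t1) /= orbb => /eqP.
by move=> /scalar_abs0_eq0 /eqP; rewrite subr_eq0 => /eqP.
Qed.

Lemma scalar_abs_expi theta : angle_range k theta ->
  abs (scalar_expi k theta) = 1.
Proof.
case: k => /= [[]->|_].
- by rewrite cos0 normr1.
- by rewrite cospi normrN normr1.
- by rewrite cos2Dsin2 sqrtr1.
Qed.

End ScalarTheory.

(** * Hermitian 2x2 matrices: rank, positivity and norm in terms of entries *)

Section HermitianMatrices.
Context {R : realType} {k : scalar_kind}.
Local Notation F := (scalar_field R k).
Local Notation conj := (scalar_conj R k).
Local Notation toF := (@scalar_of_real R k).
Local Notation abs := (@scalar_abs R k).

(** The diagonal is taken in [R], so that membership in the ball becomes a system of real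
    inequalities in [p], [q] and [abs c]. *)
Definition herm2 (p q : R) (c : F) : 'M[F]_2 :=
  mx22 (toF p) c (conj c) (toF q).

Lemma matrix2P (M N : 'M[F]_2) :
  M 0 0 = N 0 0 -> M 0 1 = N 0 1 -> M 1 0 = N 1 0 -> M 1 1 = N 1 1 -> M = N.
Proof.
have ord2 (i : 'I_2) : i = 0 \/ i = 1.
  by case: i => -[|[|//]] i; [left | right]; exact: val_inj.
move=> e00 e01 e10 e11; apply/matrixP => i j.
by case: (ord2 i) => ->; case: (ord2 j) => ->.
Qed.

Lemma det_mx22 (M : 'M[F]_2) : \det M = M 0 0 * M 1 1 - M 0 1 * M 1 0.
Proof.
have l0 : lift 0 0 = 1 :> 'I_2 by exact: val_inj.
have l1 : lift 1 0 = 0 :> 'I_2 by exact: val_inj.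
rewrite (expand_det_row _ 0) !big_ord_recl big_ord0 /cofactor !det_mx11 !mxE.
by rewrite !l0 l1 addr0 expr0 mul1r expr1 mulN1r mulrN.
Qed.

Lemma herm2E p q c :
  (herm2 p q c 0 0 = toF p) * (herm2 p q c 0 1 = c) *
  (herm2 p q c 1 0 = conj c) * (herm2 p q c 1 1 = toF q).
Proof. by rewrite !mxE. Qed.

Lemma herm2_inj p q c p' q' c' :
  herm2 p q c = herm2 p' q' c' -> [/\ p = p', q = q' & c = c'].
Proof.
move=> e; have E i j := congr1 (fun M : 'M[F]_2 => M i j) e.
move: (E 0 0) (E 0 1) (E 1 1); rewrite /= !herm2E.
by move=> /(fmorph_inj toF) -> -> /(fmorph_inj toF) ->.
Qed.

Lemma herm2_comb (t p1 q1 p2 q2 : R) (c1 c2 : F) :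
  toF t *: herm2 p1 q1 c1 + (1 - toF t) *: herm2 p2 q2 c2 =
  herm2 (t * p1 + (1 - t) * p2) (t * q1 + (1 - t) * q2)
        (toF t * c1 + (1 - toF t) * c2).
Proof.
apply: matrix2P; rewrite [RHS]herm2E !(mxE, herm2E) ?mxE /=.
- by rewrite rmorphD !rmorphM rmorphB rmorph1.
- by [].
- by rewrite rmorphD !rmorphM rmorphB rmorph1 /= !scalar_conj_of_real.
- by rewrite rmorphD !rmorphM rmorphB rmorph1.
Qed.

Lemma herm2_scale (t p q : R) (c : F) :
  toF t *: herm2 p q c = herm2 (t * p) (t * q) (toF t * c).
Proof.
apply: matrix2P; rewrite [RHS]herm2E !(mxE, herm2E) ?mxE /= ?rmorphM //.
by rewrite /= scalar_conj_of_real.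
Qed.

(** The determinant is pq - |c|^2, and a nonzero singular 2x2 matrix has rank exactly one. *)
Lemma rank_herm2 p q c : herm2 p q c <> 0 ->
  \rank (herm2 p q c) = 1%N <-> p * q = abs c ^+ 2.
Proof.
move=> /eqP; rewrite -mxrank_eq0 => rk0.
have detE : \det (herm2 p q c) = toF (p * q - abs c ^+ 2).
  rewrite det_mx22 !herm2E rmorphB rmorphM /= -scalar_mul_conj.
  by congr (_ - _).
have [full|nfull] := boolP (herm2 p q c \in unitmx).
  rewrite mxrank_unit //; split=> // e; move: full.
  by rewrite unitmxE detE e subrr rmorph0 unitr0.
have := nfull; rewrite unitmxE unitfE detE fmorph_eq0 negbK subr_eq0 => /eqP e.
split=> // _.
have := rank_leq_row (herm2 p q c); rewrite leq_eqVlt => /orP[/eqP rk2|].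
  by move: nfull; rewrite -row_free_unit /row_free rk2.
by move: rk0; case: (\rank _) => [|[]].
Qed.

Lemma quadratic_form_herm2 p q c (x : 'cV[F]_2) :
  (map_mx conj x^T *m herm2 p q c *m x) 0 0 =
  toF p * (x 0 0 * conj (x 0 0)) + c * conj (x 0 0) * x 1 0 +
  conj c * x 0 0 * conj (x 1 0) + toF q * (x 1 0 * conj (x 1 0)).
Proof.
rewrite mxE big_ord_recl big_ord1 !mxE !big_ord_recl !big_ord0 /=.
rewrite (_ : lift ord0 ord0 = 1); last exact: val_inj.
by rewrite !herm2E !mxE; ring.
Qed.

(** Necessity comes from evaluating the form at well-chosen vectors, sufficiency from completing the
    square. *)
Lemma nonneg_definite_herm2 p q c :
  nonneg_definite (herm2 p q c) <->
  [/\ 0 <= p, 0 <= q & abs c ^+ 2 <= p * q].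
Proof.
pose x2 (u v : F) : 'cV[F]_2 := \col_i (if i == 0 then u else v).
split=> [[_ pos]|[p0 q0 cpq]].
  have val u v : 0 <= toF p * (u * conj u) + c * conj u * v +
      conj c * u * conj v + toF q * (v * conj v).
    by have := pos (x2 u v); rewrite quadratic_form_herm2 !mxE.
  have p0 : 0 <= p.
    have := val 1 0; rewrite !rmorph0 !rmorph1 !(mulr0, mulr1, addr0).
    by rewrite scalar_of_real_ge0.
  have q0 : 0 <= q.
    have := val 0 1; rewrite !rmorph0 !rmorph1 !(mulr0, mulr1, addr0, add0r).
    by rewrite scalar_of_real_ge0.
  split=> //.
  have [pE|pN0] := eqVneq p 0; last first.
    (* The value of the form at (-c, p) is [p] times the determinant; the next case uses (q, -conj
       c) in the same way. *)
    have : 0 <= toF (p * (p * q - abs c ^+ 2)).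
      have := val (- c) (toF p); rewrite !rmorphN /= scalar_conj_of_real.
      congr (0 <= _).
      by rewrite rmorphM rmorphB rmorphM /= -scalar_mul_conj; ring.
    rewrite scalar_of_real_ge0 pmulr_rge0 ?subr_ge0 //.
    by rewrite lt_def pN0.
  have [qE|qN0] := eqVneq q 0; last first.
    have : 0 <= toF (q * (p * q - abs c ^+ 2)).
      have := val (toF q) (- conj c).
      rewrite !rmorphN /= scalar_conjK scalar_conj_of_real.
      congr (0 <= _).
      by rewrite rmorphM rmorphB rmorphM /= -scalar_mul_conj; ring.
    rewrite scalar_of_real_ge0 pmulr_rge0 ?subr_ge0 //.
    by rewrite lt_def qN0.
  (* With a zero diagonal, the value at (-c, 1) is -2|c|^2, which forces [c = 0]. *)
  have : 0 <= toF (- (2 * abs c ^+ 2)).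
    have := val (- c) 1; rewrite pE qE !rmorphN !rmorph0 rmorph1 /=.
    congr (0 <= _).
    by rewrite rmorphM rmorphMn rmorph1 /= -scalar_mul_conj; ring.
  by rewrite scalar_of_real_ge0 pE mul0r; lra.
split.
  apply/is_hermitianmxP; rewrite expr0 scale1r.
  by apply: matrix2P; rewrite !mxE /= ?scalar_conj_of_real ?scalar_conjK.
move=> x; rewrite quadratic_form_herm2.
move: (x 0 0) (x 1 0) => u v.
have [pE|pN0] := eqVneq p 0.
  have c0 : c = 0.
    apply: scalar_abs0_eq0; apply/eqP; rewrite -sqrf_eq0 eq_le sqr_ge0 andbT.
    by rewrite (le_trans cpq) // pE mul0r.
  rewrite pE c0 !rmorph0 !mul0r !add0r scalar_mul_conj -rmorphM.
  by rewrite scalar_of_real_ge0 mulr_ge0 ?sqr_ge0.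
have tp0 : 0 < toF p.
  by rewrite lt_def fmorph_eq0 pN0 scalar_of_real_ge0.
rewrite -(pmulr_rge0 _ tp0).
set y := _ * _.
(* Completing the square: p times the form equals |pu + cv|^2 + (pq - |c|^2)|v|^2. *)
have -> : y = (toF p * u + conj (conj c) * v) * conj (toF p * u + conj (conj c) * v) +
    toF ((p * q - abs c ^+ 2) * abs v ^+ 2).
  rewrite rmorphM rmorphB rmorphM /= -!scalar_mul_conj.
  rewrite rmorphD !rmorphM /= !scalar_conjK scalar_conj_of_real /y.
  ring.
rewrite addr_ge0 // ?scalar_mul_conj scalar_of_real_ge0 ?sqr_ge0 //.
by rewrite mulr_ge0 ?sqr_ge0 // subr_ge0.
Qed.

(** The triangle inequality bounds the supremum, and a vector aligning the phases of all the terms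
    attains the bound. *)
Lemma infty_one_norm_herm2 p q c : 0 <= p -> 0 <= q ->
  infty_one_norm (herm2 p q c) = p + q + 2 * abs c.
Proof.
move=> p0 q0; rewrite /infty_one_norm; set S := (X in sup X).
have ub : ubound S (p + q + 2 * abs c).
  move=> _ [x /= x1 <-].
  have x1i i : abs (x i 0) <= 1.
    by apply: le_trans x1; rewrite /linfty_norm; exact: le_bigmax.
  rewrite /l1_norm !big_ord_recl big_ord0 !mxE !big_ord_recl !big_ord0.
  rewrite (_ : lift ord0 ord0 = 1); last exact: val_inj.
  rewrite !herm2E !addr0.
  have bnd (d e : F) : abs (d * x 0 0 + e * x 1 0) <= abs d + abs e.
    apply: le_trans (scalar_absD _ _) _; rewrite !scalar_absM.
    by apply: lerD; rewrite ler_piMr ?scalar_abs_ge0.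
  apply: le_trans (lerD (bnd _ _) (bnd _ _)) _.
  by rewrite scalar_abs_conj !scalar_abs_of_real //; lra.
have [u [u1 cu cE]] := scalar_phase c.
(* The vector (1, u) is sent to (p + |c|, (|c| + q)u), where |u| = 1. *)
have inS : S (p + q + 2 * abs c).
  exists (\col_i (if i == 0 then 1 else u)) => /=.
    rewrite /linfty_norm; apply/bigmax_leP; split=> // i _.
    rewrite mxE; case: ifP; rewrite ?u1 // -(rmorph1 toF).
    by rewrite scalar_abs_of_real.
  rewrite /l1_norm !big_ord_recl big_ord0 !mxE !big_ord_recl !big_ord0.
  rewrite (_ : lift ord0 ord0 = 1); last exact: val_inj.
  rewrite !herm2E !mxE /= !addr0 !mulr1 cu cE -mulrDl -!rmorphD.
  have c0 := scalar_abs_ge0 c.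
  by rewrite scalar_absM u1 !scalar_abs_of_real ?addr_ge0 //; ring.
apply/eqP; rewrite eq_le ge_sup //=; last by exists (p + q + 2 * abs c).
by apply: ub_le_sup => //; exists (p + q + 2 * abs c).
Qed.

Lemma A_infty_one_herm2 p q c :
  A_infty_one (herm2 p q c) <->
  [/\ 0 <= p, 0 <= q, abs c ^+ 2 <= p * q & p + q + 2 * abs c <= 1].
Proof.
rewrite /A_infty_one /= nonneg_definite_herm2; split.
  by move=> [[p0 q0 ->]]; rewrite infty_one_norm_herm2.
by move=> [p0 q0 ->]; rewrite infty_one_norm_herm2.
Qed.

Lemma nonneg_definite_is_herm2 (M : 'M[F]_2) :
  nonneg_definite M -> exists p q c, M = herm2 p q c.
Proof.
move=> [/is_hermitianmxP]; rewrite expr0 scale1r => hM pos.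
have E i j : M j i = conj (M i j) by rewrite {1}hM !mxE.
(* A diagonal entry is the value of the form at a basis vector, hence real and nonnegative. *)
have diag i : 0 <= M i i.
  by have := pos (delta_mx i 0); rewrite trmx_delta map_delta_mx -rowE -colE !mxE.
have [p _ pE] := scalar_ge0P _ (diag 0).
have [q _ qE] := scalar_ge0P _ (diag 1).
by exists p, q, (M 0 1); apply: matrix2P; rewrite herm2E.
Qed.

End HermitianMatrices.

(** * Real inequalities on diagonals and moduli *)

(** After squaring, this follows from 4 r1^2 r2^2 <= 4 (p1 q2)(p2 q1) <= (p1 q2 + p2 q1)^2. *)
Lemma cross_product_ge (R : realFieldType) (p1 q1 r1 p2 q2 r2 : R) :
  0 <= p1 -> 0 <= q1 -> 0 <= r1 -> 0 <= p2 -> 0 <= q2 -> 0 <= r2 ->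
  r1 ^+ 2 <= p1 * q1 -> r2 ^+ 2 <= p2 * q2 ->
  2 * (r1 * r2) <= p1 * q2 + p2 * q1.
Proof.
move=> p1_ge0 q1_ge0 r1_ge0 p2_ge0 q2_ge0 r2_ge0 r1_le r2_le.
rewrite -(@ler_pXn2r _ 2) ?nnegrE ?addr_ge0 ?mulr_ge0 //.
have : r1 ^+ 2 * r2 ^+ 2 <= p1 * q1 * (p2 * q2) by rewrite ler_pM ?sqr_ge0.
have := sqr_ge0 (p1 * q2 - p2 * q1).
by nra.
Qed.

(** This is the converse direction at the level of moduli. The corner modulus [r] is only bounded by
    the combination of [r1] and [r2], since the phases of the two corners may differ. *)
Lemma rank_one_unit_extreme (R : realFieldType) (t p1 q1 r1 p2 q2 r2 : R) :
  0 < t < 1 ->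
  0 <= p1 -> 0 <= q1 -> 0 <= r1 -> 0 <= p2 -> 0 <= q2 -> 0 <= r2 ->
  r1 ^+ 2 <= p1 * q1 -> r2 ^+ 2 <= p2 * q2 ->
  p1 + q1 + 2 * r1 <= 1 -> p2 + q2 + 2 * r2 <= 1 ->
  let p := t * p1 + (1 - t) * p2 in let q := t * q1 + (1 - t) * q2 in
  forall r, r <= t * r1 + (1 - t) * r2 -> p + q + 2 * r = 1 ->
    p * q = r ^+ 2 -> [/\ p1 = p2, q1 = q2, r1 = r2 & r = r1].
Proof.
move=> /andP[t_gt0 t_lt1] p1_ge0 q1_ge0 r1_ge0 p2_ge0 q2_ge0 r2_ge0 r1_le r2_le.
move=> s1_le s2_le p q r r_le s_eq1 pq_eq.
have t'_gt0 : 0 < 1 - t by rewrite subr_gt0.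
(* The value 1 is at most a weighted mean of two norms that are at most 1, so every inequality in
   the chain is an equality. *)
have s1_eq1 : p1 + q1 + 2 * r1 = 1 by rewrite /p /q in s_eq1; nra.
have s2_eq1 : p2 + q2 + 2 * r2 = 1 by rewrite /p /q in s_eq1; nra.
have rE : r = t * r1 + (1 - t) * r2 by rewrite /p /q in s_eq1; nra.
have cross_ge := @cross_product_ge R p1 q1 r1 p2 q2 r2 p1_ge0 q1_ge0 r1_ge0
  p2_ge0 q2_ge0 r2_ge0 r1_le r2_le.
(* Expanding pq - r^2 = 0 gives three nonnegative terms, each of which must vanish. *)
have defect : t ^+ 2 * (p1 * q1 - r1 ^+ 2)
    + (1 - t) ^+ 2 * (p2 * q2 - r2 ^+ 2)
    + t * (1 - t) * (p1 * q2 + p2 * q1 - 2 * (r1 * r2)) = 0.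
  by transitivity (p * q - r ^+ 2); [rewrite rE /p /q; ring | rewrite pq_eq subrr].
have d1 : 0 <= t ^+ 2 * (p1 * q1 - r1 ^+ 2) by rewrite mulr_ge0 ?sqr_ge0 ?subr_ge0.
have d2 : 0 <= (1 - t) ^+ 2 * (p2 * q2 - r2 ^+ 2)
  by rewrite mulr_ge0 ?sqr_ge0 ?subr_ge0.
have d3 : 0 <= t * (1 - t) * (p1 * q2 + p2 * q1 - 2 * (r1 * r2)).
  by rewrite mulr_ge0 ?subr_ge0 // mulr_ge0 ?ltW.
have [r1E r2E crossE] :
    [/\ p1 * q1 = r1 ^+ 2, p2 * q2 = r2 ^+ 2 & p1 * q2 + p2 * q1 = 2 * (r1 * r2)].
  move/eqP: defect; rewrite !paddr_eq0 ?addr_ge0 // !mulf_eq0.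
  rewrite !(gt_eqF t_gt0, gt_eqF t'_gt0) /= !subr_eq0.
  by move=> /andP[/andP[/eqP -> /eqP ->] /eqP ->].
(* [p_i + r_i] is the square root of [p_i], and [q_i + r_i] that of [q_i]. *)
have p1E : p1 = (p1 + r1) ^+ 2.
  have : (p1 + r1) ^+ 2 = p1 * (p1 + q1 + 2 * r1) by ring: r1E.
  by rewrite s1_eq1 mulr1.
have p2E : p2 = (p2 + r2) ^+ 2.
  have : (p2 + r2) ^+ 2 = p2 * (p2 + q2 + 2 * r2) by ring: r2E.
  by rewrite s2_eq1 mulr1.
set x1 := p1 + r1 in p1E; set x2 := p2 + r2 in p2E.
have r1x : r1 = x1 - x1 ^+ 2 by rewrite -p1E /x1; ring.
have r2x : r2 = x2 - x2 ^+ 2 by rewrite -p2E /x2; ring.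
have q1x : q1 = (1 - x1) ^+ 2 by have := p1E; lra.
have q2x : q2 = (1 - x2) ^+ 2 by have := p2E; lra.
(* With p = x^2, r = x(1-x) and q = (1-x)^2 on both sides, the cross equality reduces to (x1 - x2)^2
   = 0. *)
have x12 : x1 = x2.
  apply/eqP; rewrite -subr_eq0 -sqrf_eq0; apply/eqP.
  by move: crossE; rewrite r1x r2x q1x q2x {1}p1E {1}p2E; lra.
have r12 : r1 = r2 by rewrite r1x r2x x12.
by split=> //; [rewrite p1E p2E x12 | rewrite q1x q2x x12 | rewrite rE r12; ring].
Qed.

(** * Extreme points of the ball among Hermitian matrices *)

Section ExtremePoints.
Context {R : realType} {k : scalar_kind}.
Local Notation F := (scalar_field R k).
Local Notation toF := (@scalar_of_real R k).
Local Notation abs := (@scalar_abs R k).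

Lemma scalar_of_real_itv01 (t : R) : (0 < toF t < 1) = (0 < t < 1).
Proof.
by rewrite -(rmorph0 toF) -[1 in LHS](rmorph1 toF) /= !scalar_of_real_lt.
Qed.

Lemma extreme_herm2_norm (p q : R) (c : F) : herm2 p q c <> 0 ->
  extreme_point (@A_infty_one R k 2) (herm2 p q c) -> p + q + 2 * abs c = 1.
Proof.
move=> T_neq0 [/A_infty_one_herm2[p_ge0 q_ge0 c_le s_le1] ext].
have c_ge0 := scalar_abs_ge0 c; set s := p + q + 2 * abs c in s_le1 *.
have herm2_0 : herm2 0 0 0 = 0 :> 'M[F]_2.
  by apply: matrix2P; rewrite herm2E mxE ?rmorph0.
have s_gt0 : 0 < s.
  rewrite lt_def; apply/andP; split; last by rewrite /s; lra.
  apply/eqP => s0; apply: T_neq0.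
  have [-> -> /scalar_abs0_eq0 ->] : [/\ p = 0, q = 0 & abs c = 0].
    by rewrite /s in s0; split; lra.
  exact: herm2_0.
apply/eqP; rewrite eq_le s_le1 leNgt; apply/negP => s_lt1.
(* If 0 < s < 1, the matrix is the combination, with weights s and 1 - s, of its normalization and
   zero; extremality then makes it zero. *)
have V_gt0 : 0 < s^-1 by rewrite invr_gt0.
have [||||_ T0] := ext (herm2 (s^-1 * p) (s^-1 * q) (toF s^-1 * c))
  (herm2 0 0 0) (toF s).
- apply/A_infty_one_herm2; rewrite scalar_absM (scalar_abs_of_real _ (ltW V_gt0)).
  split; try by rewrite mulr_ge0 // ltW.
    by rewrite exprMn [leRHS]mulrACA -expr2 ler_wpM2l ?sqr_ge0.
  have -> : s^-1 * p + s^-1 * q + 2 * (s^-1 * abs c) = s^-1 * s.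
    by move: (s^-1) => v; rewrite /s; ring.
  by rewrite mulVf ?gt_eqF.
- by apply/A_infty_one_herm2; rewrite -(rmorph0 toF) scalar_abs_of_real.
- by rewrite scalar_of_real_itv01 s_gt0.
- rewrite herm2_0 scaler0 addr0 herm2_scale !mulrA -rmorphM /=.
  by rewrite divff ?gt_eqF // rmorph1 !mul1r.
- by apply: T_neq0; rewrite -T0.
Qed.

Lemma extreme_herm2_det (p q : R) (c : F) :
  extreme_point (@A_infty_one R k 2) (herm2 p q c) -> p * q = abs c ^+ 2.
Proof.
move=> [/A_infty_one_herm2[p_ge0 q_ge0 c_le s_le1] ext].
have c_ge0 := scalar_abs_ge0 c; have c2_ge0 := sqr_ge0 (abs c).
apply/eqP; rewrite eq_le c_le andbT leNgt; apply/negP => c_lt.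
(* Half the determinant is a small enough shift: 2e <= pq and p, q <= 1 keep the diagonal
   nonnegative, and (p+e)(q-e) loses at most ep + e^2 <= 2e from pq. The trace and the corner do not
   change. *)
pose e := (p * q - abs c ^+ 2) / 2.
have pqE : p * q = abs c ^+ 2 + 2 * e by rewrite /e; field.
have e_gt0 : 0 < e by lra.
have p_le1 : p <= 1 by lra.
have q_le1 : q <= 1 by lra.
have [pq_le_p pq_le_q] : p * q <= p /\ p * q <= q.
  by rewrite ler_piMr // ler_piMl.
have e2 : e ^+ 2 <= e * 1 by rewrite expr2 ler_pM2l //; lra.
have ep_le : e * p <= e * 1 by rewrite ler_pM2l.
have eq_le : e * q <= e * 1 by rewrite ler_pM2l.
have [ep_ge0 eq_ge0] : 0 <= e * p /\ 0 <= e * q by split; rewrite mulr_ge0 ?(ltW e_gt0).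
have [||||/herm2_inj[pE _ _] _] := ext (herm2 (p + e) (q - e) c)
  (herm2 (p - e) (q + e) c) (toF 2^-1).
- by apply/A_infty_one_herm2; split; lra.
- by apply/A_infty_one_herm2; split; lra.
- by rewrite scalar_of_real_itv01; lra.
- rewrite herm2_comb; congr herm2; [by field | by field |].
  by rewrite -mulrDl addrC subrK mul1r.
- by lra.
Qed.

Lemma extreme_herm2P (p q : R) (c : F) :
  A_infty_one (herm2 p q c) -> herm2 p q c <> 0 ->
  extreme_point (@A_infty_one R k 2) (herm2 p q c) <->
  p * q = abs c ^+ 2 /\ p + q + 2 * abs c = 1.
Proof.
move=> T_in T_neq0; split=> [ext|[pq_eq s_eq1]].
  by split; [exact: extreme_herm2_det | exact: extreme_herm2_norm].
split=> // y z t Ay Az t01.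
(* Over the complex numbers the partial order makes the weight [t] real. *)
have [t' _ tE] := scalar_ge0P _ (ltW (andP t01).1).
have t'01 : 0 < t' < 1 by rewrite -scalar_of_real_itv01 -tE.
have [p1 [q1 [c1 yE]]] := nonneg_definite_is_herm2 _ Ay.1.
have [p2 [q2 [c2 zE]]] := nonneg_definite_is_herm2 _ Az.1.
move: Ay Az; rewrite yE zE tE.
move=> /A_infty_one_herm2[p1_ge0 q1_ge0 c1_le s1_le].
move=> /A_infty_one_herm2[p2_ge0 q2_ge0 c2_le s2_le].
rewrite herm2_comb => /herm2_inj[pE qE cE].
have c_le : abs c <= t' * abs c1 + (1 - t') * abs c2.
  have [t0 t1] : 0 <= t' /\ 0 <= 1 - t' by lra.
  rewrite cE; apply: le_trans (scalar_absD _ _) _.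
  rewrite -(rmorph1 toF) -rmorphB !scalar_absM.
  by rewrite !scalar_abs_of_real.
have [||p12 q12 r12 rE] := rank_one_unit_extreme _ _ _ _ _ _ _ _ t'01
  p1_ge0 q1_ge0 (scalar_abs_ge0 c1) p2_ge0 q2_ge0 (scalar_abs_ge0 c2)
  c1_le c2_le s1_le s2_le _ c_le; rewrite -?pE -?qE //.
(* The moduli now agree with that of the combination, so strict convexity aligns the phases. *)
have c12 : c1 = c2.
  by apply: (scalar_abs_strictly_convex _ _ _ t'01 r12); rewrite -cE.
have -> : p = p1 by rewrite pE -p12; ring.
have -> : q = q1 by rewrite qE -q12; ring.
have -> : c = c1 by rewrite cE -c12; ring.
by rewrite p12 q12 c12.
Qed.

End ExtremePoints.

Theorem theorem2p18 (R : realType) (k : scalar_kind) (T : 'M[scalar_field R k]_2)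
    (a b r theta : R)
    (T_in : A_infty_one T) (T_neq0 : T <> 0)
    (a_ge0 : 0 <= a) (b_ge0 : 0 <= b) (r_ge0 : 0 <= r)
    (theta_range : angle_range k theta)
    (T_polar : T = polar_mx k a b r theta) :
  extreme_point (@A_infty_one R k 2) T <->
  \rank T = 1%N /\ a + b + 2 * r = 1.
Proof.
have [p [q [c TE]]] := nonneg_definite_is_herm2 _ T_in.1.
(* Since the phase factor has modulus 1, the polar data are exactly the diagonal and the corner
   modulus. *)
have [pE qE rE] : [/\ p = a, q = b & scalar_abs c = r].
  have E i j : herm2 p q c i j = polar_mx k a b r theta i j.
    by rewrite -TE T_polar.
  move: (E 0 0) (E 1 1) (E 0 1); rewrite !herm2E !mxE /=.
  move=> /(fmorph_inj (@scalar_of_real R k)) -> /(fmorph_inj (@scalar_of_real R k)) -> ->; split=> //.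
  by rewrite scalar_absM scalar_abs_of_real // scalar_abs_expi // mulr1.
rewrite TE in T_in T_neq0 *.
by rewrite -pE -qE -rE (rank_herm2 _ _ _ T_neq0); apply: extreme_herm2P.
Qed.
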